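(* Consider the scalar two-player $\gamma$-discounted linear quadratic game with parameters $a\neq 0$, $\gamma\in(0,1]$, $\sigma_1,\sigma_2>0$, $r_1,r_2>0$, and let $i$ be the player with $\sigma_i>\sigma_{-i}$. Then: (1) the game always admits a unique stable Feedback Nash Equilibrium $(x_i^\star,x_{-i}^\star)$ that satisfies the bounded branch $x_{-i}^\star=r_-^{(i,-i)}(x_i^\star)$, where $$r_-^{(i,-i)}(x)=\frac{\sigma_i+x^2-\sqrt{(\sigma_i+x^2)^2-4\sigma_{-i}x^2}}{2x},\qquad x\neq 0;$$ (2) the game may admit multiple stable Feedback Nash Equilibria only if $$|a|\ge \sqrt{\sigma_i}+\sqrt{\sigma_i-\sigma_{-i}},$$ i.e. if the game admits more than one stable Feedback Nash Equilibrium, then this inequality holds.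
   Context: For a player index $i\in\{1,2\}$, $-i$ denotes the other player. The game: the scalar state evolves as $s_{t+1}=a s_t+u_{1,t}+u_{2,t}$, $t=0,1,2,\dots$, with $a\in\mathbb{R}$, and each player uses a linear feedback $u_{i,t}=x_i s_t$ with policy $x_i\in\mathbb{R}$. For $x=(x_1,x_2)$ put $a_{\mathrm{cl}}(x)=a+x_1+x_2$, so $s_t=a_{\mathrm{cl}}(x)^t s_0$. Player $i$'s value function is $$V^{(i)}(s_0;x_i,x_{-i})=\sum_{t=0}^\infty \gamma^t r_i(\sigma_i s_t^2+u_{i,t}^2)=s_0^2 r_i(\sigma_i+x_i^2)\sum_{t=0}^\infty(\gamma a_{\mathrm{cl}}^2(x))^t\in[0,\infty].$$ A pair $x^\star=(x_1^\star,x_2^\star)\in\mathbb{R}^2$ is a Feedback Nash Equilibrium (FNE) if for all $s_0\in\mathbb{R}$, each player $i$ and each $x_i\in\mathbb{R}$, $V^{(i)}(s_0;x_i^\star,x_{-i}^\star)\le V^{(i)}(s_0;x_i,x_{-i}^\star)$. It is a stable FNE if in addition $|a_{\mathrm{cl}}(x^\star)|<1$. The FNE law is the relation $\frac{\sigma_i}{x_i}+x_i-\left(\frac{\sigma_{-i}}{x_{-i}}+x_{-i}\right)=0$; solved for $x_{-i}$ it has two branches $r_\pm^{(i,-i)}(x_i)=\frac{\sigma_i+x_i^2\pm\sqrt{(\sigma_i+x_i^2)^2-4\sigma_{-i}x_i^2}}{2x_i}$, of which $r_-^{(i,-i)}$ is called the bounded branch and $r_+^{(i,-i)}$ the unbounded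 branch.
   Formalization: For γ<1 existence in (1) fails with |a_cl|<1 (e.g. a=10, γ=1/400, σ's ≤1), so existence is proved with discounted stability √γ|a_cl|<1; existence with |a_cl|<1 is stated for γ=1 only, while uniqueness and (2) hold for both notions. *)

(* Defs.v *)
From HB Require Import structures.
From mathcomp Require Import all_boot all_order all_algebra.
From mathcomp Require Import all_classical all_reals all_analysis.

Set Implicit Arguments.
Unset Strict Implicit.
Unset Printing Implicit Defensive.

Import Order.TTheory GRing.Theory Num.Theory.

Local Open Scope ring_scope.

(* The two players are the two booleans; the opponent -i of i is ~~ i.
   A policy profile is a function from players to feedback gains. *)
Definition player : finType := bool.

Definition profile (R : realType) := {ffun player -> R}.

Section LQGame.
Variables (R : realType) (a gamma : R) (sigma r : player -> R).

(* [xi] is the gain of the player under consideration, [xo] the opponent's. *)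
Fixpoint state (xi xo s0 : R) (t : nat) : R :=
  if t is t'.+1 then
    let s := state xi xo s0 t' in a * s + xi * s + xo * s
  else s0.

(* A series of nonnegative terms, with value in [0, +oo]. *)
Definition value (i : player) (s0 xi xo : R) : \bar R :=
  (\sum_(0 <= t <oo)
    (gamma ^+ t * (r i * (sigma i * state xi xo s0 t ^+ 2
                          + (xi * state xi xo s0 t) ^+ 2)))%:E)%E.

Definition FNE (x : profile R) : Prop :=
  forall (s0 : R) (i : player) (y : R),
    (value i s0 (x i) (x (~~ i)) <= value i s0 y (x (~~ i)))%E.

Definition a_cl (x : profile R) : R := a + x true + x false.

Definition stable_FNE (x : profile R) : Prop := FNE x /\ `|a_cl x| < 1.

(* Stability of the discounted closed loop sqrt gamma * a_cl, which is the
   same as stability when gamma = 1. For gamma < 1 it is weaker, and only it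
   can be guaranteed at an equilibrium: with a = 10, gamma = 1/400 and
   sigma j <= 1 the stationarity condition
     x j * (1 - gamma * c^2) + gamma * c * (sigma j + (x j)^2) = 0, c = a_cl x,
   has no solution with `|c| < 1, so that no FNE x satisfies `|a_cl x| < 1. *)
Definition discounted_stable_FNE (x : profile R) : Prop :=
  FNE x /\ Num.sqrt gamma * `|a_cl x| < 1.

Definition r_minus (i : player) (x : R) : R :=
  (sigma i + x ^+ 2
   - Num.sqrt ((sigma i + x ^+ 2) ^+ 2 - 4 * sigma (~~ i) * x ^+ 2)) / (2 * x).

(* The formula for r_minus is meaningful for a nonzero argument only. *)
Definition on_bounded_branch (i : player) (x : profile R) : Prop :=
  x i != 0 /\ x (~~ i) = r_minus i (x i).

End LQGame.

Definition multiple (T : Type) (P : T -> Prop) : Prop :=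
  exists x y : T, [/\ x <> y, P x & P y].

(* Main.v *)
Require Import Defs.
From HB Require Import structures.
From mathcomp Require Import all_boot all_order all_algebra.
From mathcomp Require Import all_classical all_reals all_analysis.
From mathcomp Require Import ring lra.

Set Implicit Arguments.
Unset Strict Implicit.
Unset Printing Implicit Defensive.

Import Order.TTheory GRing.Theory Num.Theory.
Import numFieldNormedType.Exports.

Local Open Scope ring_scope.

(** Against a fixed opponent, a player minimises the quotient
    (sigma + x^2) / (1 - gamma * c^2) of two quadratics, where c is the closed
    loop. Minimality of x with minimal value P says that the convex quadratic
    sigma + y^2 - P * (1 - gamma * c(y)^2) in y is nonnegative and vanishes
    at x, which is the same as a vanishing derivative at x. So the
    equilibria with gamma * c^2 < 1 are exactly the solutions of the two
    stationarity equations
    ([FNE_stationary]).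

    Changing the signs of a, x_1 and x_2 preserves everything, so let a > 0.
    Then c > 0 and both gains are negative. Write them as - w for the player
    with the larger weight S and - v for the other, of weight s. Both
    stationarity equations then say that
      w + S / w = v + s / v = 1 / (gamma * c) - c.
    Let k be this common value. It determines c as
    (sqrt (k^2 + 4 / gamma) - k) / 2, and v as one of
    (k -+ sqrt (k^2 - 4 s)) / 2, the minus sign being the bounded branch.

    On the bounded branch the identity a = w + v + c reads
      a = w + (sqrt (k^2 + 4 / gamma) - sqrt (k^2 - 4 s)) / 2,
    a function of w alone. It is strictly increasing ([openloop_lt]) and takes
    every positive value ([openloop_surj]), whence existence and uniqueness.

    Hence, if there are two equilibria, one of them has
    v = (k + sqrt (k^2 - 4 s)) / 2. As k >= 2 sqrt S, this is at least
    sqrt S + sqrt (S - s), and a > v ([upper_gain_pair]). *)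

(** * Best responses and stationarity *)

Section BestResponse.
Variables (R : realType) (gamma s b : R).
Hypotheses (gamma_gt0 : 0 < gamma) (s_gt0 : 0 < s).

(** The discounted cost per unit of r * s0^2, when gamma (b + x)^2 < 1. *)
Definition cost (x : R) : R := (s + x ^+ 2) / (1 - gamma * (b + x) ^+ 2).

(** Half the numerator of the derivative of [cost]. *)
Definition stationary (x : R) : Prop :=
  x * (1 - gamma * (b + x) ^+ 2) + gamma * (b + x) * (s + x ^+ 2) = 0.

(** With P the cost of x, comparing it to the cost of y amounts to the sign of
    s + y^2 - P (1 - gamma (b + y)^2), a convex quadratic in y with a zero at x.
    Unstable y may be included, since there this quadratic is positive anyway;
    so it is nonnegative on the whole line iff its derivative vanishes at x. *)
Lemma stationaryP (x : R) : gamma * (b + x) ^+ 2 < 1 ->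
  (forall y, gamma * (b + y) ^+ 2 < 1 -> cost x <= cost y) <-> stationary x.
Proof.
move=> x_lt1; set c := b + x in x_lt1 *; set P := cost x.
have den_gt0 : 0 < 1 - gamma * c ^+ 2 by rewrite subr_gt0.
have sx_gt0 : 0 < s + x ^+ 2 by rewrite ltr_pwDl // sqr_ge0.
have P_gt0 : 0 < P by rewrite /P /cost divr_gt0.
have PE : P * (1 - gamma * c ^+ 2) = s + x ^+ 2.
  by rewrite /P /cost mulfVK // lt0r_neq0.
have gP_gt0 : 0 < P * gamma by rewrite mulr_gt0.
have quadE y : s + y ^+ 2 - P * (1 - gamma * (b + y) ^+ 2) =
    2 * (y - x) * (x + P * gamma * c) + (y - x) ^+ 2 * (1 + P * gamma).
  rewrite -[LHS]subr0 -[X in _ - X](subrr (s + x ^+ 2)) -{2}PE /c; ring.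
have statE : x * (1 - gamma * c ^+ 2) + gamma * c * (s + x ^+ 2) =
    (1 - gamma * c ^+ 2) * (x + P * gamma * c) by rewrite -PE; ring.
have costE y : gamma * (b + y) ^+ 2 < 1 ->
    (P <= cost y) = (0 <= s + y ^+ 2 - P * (1 - gamma * (b + y) ^+ 2)).
  by move=> y_lt1; rewrite /cost ler_pdivlMr ?subr_gt0 // subr_ge0.
rewrite /stationary -/c statE; split => [minx|].
  have quad_ge0 y : 0 <= s + y ^+ 2 - P * (1 - gamma * (b + y) ^+ 2).
    have [y_lt1|y_ge1] := ltP (gamma * (b + y) ^+ 2) 1.
      by rewrite -costE // minx.
    rewrite addr_ge0 //; first by rewrite addr_ge0 ?sqr_ge0 // ltW.
    by rewrite -mulrN mulr_ge0 ?(ltW P_gt0) // opprB subr_ge0.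
  have gP1_gt0 : 0 < 1 + P * gamma by rewrite addr_gt0.
  set L := x + P * gamma * c.
  (* The vertex of the quadratic, where its value is - L^2 / (1 + P gamma). *)
  have := quad_ge0 (x - L / (1 + P * gamma)).
  rewrite quadE -/L.
  have -> : 2 * (x - L / (1 + P * gamma) - x) * L +
      (x - L / (1 + P * gamma) - x) ^+ 2 * (1 + P * gamma) =
      - (L ^+ 2 / (1 + P * gamma)) by field; rewrite lt0r_neq0.
  rewrite oppr_ge0 pmulr_lle0 ?invr_gt0 // => L2_le0.
  have /eqP : L ^+ 2 = 0 by apply/eqP; rewrite eq_le L2_le0 sqr_ge0.
  by rewrite sqrf_eq0 => /eqP ->; rewrite mulr0.
move=> /eqP; rewrite mulf_eq0 (gt_eqF den_gt0) /= => /eqP L0 y y_lt1.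
by rewrite costE // quadE L0 mulr0 add0r mulr_ge0 ?sqr_ge0 // addr_ge0 // ltW.
Qed.

End BestResponse.

(** * The value function *)

Section Value.
Variables (R : realType) (a gamma : R) (sigma r : player -> R).
Hypotheses (gamma_gt0 : 0 < gamma).
Hypotheses (sigma_gt0 : forall j, 0 < sigma j) (r_gt0 : forall j, 0 < r j).

Lemma stateE (xi xo s0 : R) t : state a xi xo s0 t = (a + xo + xi) ^+ t * s0.
Proof. by elim: t => [|t /= ->]; rewrite ?mul1r // exprS; ring. Qed.

Lemma value_geometric (j : player) (s0 xi xo : R) :
  value a gamma sigma r j s0 xi xo =
  (\sum_(0 <= t <oo) (geometric (s0 ^+ 2 * r j * (sigma j + xi ^+ 2))
                       (gamma * (a + xo + xi) ^+ 2) t)%:E)%E.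
Proof.
apply: eq_eseriesr => t _; congr EFin.
by rewrite stateE /geometric /= [(gamma * _) ^+ t]exprMn exprAC; ring.
Qed.

Lemma value_stable (j : player) (s0 xi xo : R) :
  gamma * (a + xo + xi) ^+ 2 < 1 ->
  value a gamma sigma r j s0 xi xo =
  (s0 ^+ 2 * r j * cost gamma (sigma j) (a + xo) xi)%:E.
Proof.
move=> z_lt1; rewrite value_geometric /cost mulrA.
set A := _ * (_ + _); set z := gamma * _ in z_lt1 *.
have z_ge0 : 0 <= z by rewrite mulr_ge0 ?sqr_ge0 // ltW.
apply: cvg_lim => //.
under eq_fun do rewrite sumEFin.
apply: cvg_EFin; first exact: nearW.
by apply: cvg_geometric_series; rewrite ger0_norm.
Qed.

Lemma value_ge0 (j : player) (s0 xi xo : R) :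
  (0 <= value a gamma sigma r j s0 xi xo)%E.
Proof.
apply: nneseries_ge0 => t _ _; rewrite lee_fin.
have r_ge0 := ltW (r_gt0 j); have sigma_ge0 := ltW (sigma_gt0 j).
by rewrite !(sqr_ge0, mulr_ge0, addr_ge0) ?exprn_ge0 // ltW.
Qed.

(** The partial sums of the geometric series grow at least linearly. *)
Lemma value_unstable (j : player) (s0 xi xo : R) : s0 != 0 ->
  1 <= gamma * (a + xo + xi) ^+ 2 ->
  value a gamma sigma r j s0 xi xo = +oo%E.
Proof.
move=> s0_neq0 z_ge1; rewrite value_geometric.
set A := _ * (_ + _); set z := gamma * _ in z_ge1 *.
have A_gt0 : 0 < A.
  have s02_gt0 : 0 < s0 ^+ 2 by rewrite exprn_even_gt0.
  have cost_gt0 : 0 < sigma j + xi ^+ 2 by rewrite ltr_pwDl ?sqr_ge0.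
  exact: mulr_gt0 (mulr_gt0 s02_gt0 (r_gt0 j)) cost_gt0.
have term_ge t : A <= geometric A z t.
  by rewrite /geometric /= ler_peMr ?exprn_ege1 // ltW.
apply/eqyP => M M_gt0; set n := (Num.truncn (M / A)).+1.
apply: (@le_trans _ _ (\sum_(0 <= t < n) (geometric A z t)%:E)%E); last first.
  apply: nneseries_lim_ge => t _ _; rewrite lee_fin.
  exact: le_trans (ltW A_gt0) (term_ge t).
rewrite sumEFin lee_fin.
apply: (@le_trans _ _ (\sum_(0 <= t < n) A)); last exact: ler_sum.
rewrite sumr_const_nat subn0 -mulr_natl -ler_pdivrMr //.
by rewrite ltW // truncnS_gt.
Qed.

Lemma a_clE (x : profile R) (j : player) : a_cl a x = a + x (~~ j) + x j.
Proof. by rewrite /a_cl; case: j => /=; ring. Qed.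

(** A destabilising deviation costs +oo unless s0 = 0, where all costs of stable
    loops vanish; so only stable deviations matter, as in [stationaryP]. *)
Lemma FNE_stationary (x : profile R) : gamma * a_cl a x ^+ 2 < 1 ->
  FNE a gamma sigma r x <->
  forall j, stationary gamma (sigma j) (a + x (~~ j)) (x j).
Proof.
move=> x_lt1; split=> [ne j|st s0 j y].
  have xj_lt1 : gamma * (a + x (~~ j) + x j) ^+ 2 < 1 by rewrite -a_clE.
  apply/stationaryP => // y y_lt1.
  have := ne 1 j y; rewrite !value_stable // lee_fin ler_pM2l //.
  by rewrite expr1n mul1r.
have xj_lt1 : gamma * (a + x (~~ j) + x j) ^+ 2 < 1 by rewrite -a_clE.
have [->|s0_neq0] := eqVneq s0 0.
  by rewrite value_stable // expr0n !mul0r value_ge0.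
have [y_lt1|y_ge1] := ltP (gamma * (a + x (~~ j) + y) ^+ 2) 1; last first.
  by rewrite [leRHS]value_unstable // leey.
rewrite !value_stable // lee_fin ler_pM2l; last first.
  by rewrite mulr_gt0 // exprn_even_gt0.
by have /stationaryP := st j; apply.
Qed.

End Value.

(** * Reduction to one equation in one gain *)

Section BranchFunctions.
Variables (R : realType) (gamma S s : R).
Hypotheses (gamma_gt0 : 0 < gamma) (s_gt0 : 0 < s) (s_lt : s < S).

Let S_gt0 : 0 < S := lt_trans s_gt0 s_lt.

(** The common value in the FNE law, up to sign. *)
Definition fne_const (w : R) : R := w + S / w.
(** The distance between the two roots v of v + s / v = fne_const w. *)
Definition opp_gap (w : R) : R := Num.sqrt (fne_const w ^+ 2 - 4 * s).
(** The distance between the two roots c of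
    gamma * (c^2 + fne_const w * c) = 1. *)
Definition cl_gap (w : R) : R := Num.sqrt (fne_const w ^+ 2 + 4 / gamma).
(** The coefficient a = w + v + c for which - w belongs to an equilibrium, when
    v is the smaller root and c the positive one. *)
Definition openloop (w : R) : R := w + (cl_gap w - opp_gap w) / 2.

Lemma fne_const_gt0 (w : R) : 0 < w -> 0 < fne_const w.
Proof. by move=> w_gt0; rewrite addr_gt0 ?divr_gt0. Qed.

(** The identity (w + S / w)^2 - (w - S / w)^2 = 4 S turns square roots of
    fne_const^2 into square roots of (w - S / w)^2, and w - S / w, unlike
    fne_const, is monotone in w > 0. *)
Lemma fne_constE (w : R) : w != 0 ->
  fne_const w ^+ 2 = (w - S / w) ^+ 2 + 4 * S.
Proof. by move=> w_neq0; rewrite /fne_const; field. Qed.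

Lemma opp_gap_sqr (w : R) : w != 0 -> opp_gap w ^+ 2 = fne_const w ^+ 2 - 4 * s.
Proof.
move=> w_neq0; rewrite sqr_sqrtr // fne_constE //.
by have := sqr_ge0 (w - S / w); move: s_lt; lra.
Qed.

Lemma opp_gap_gt (w : R) : w != 0 -> `|w - S / w| < opp_gap w.
Proof.
move=> w_neq0; rewrite -(ltr_pXn2r (n := 2)) // ?nnegrE ?sqrtr_ge0 //.
rewrite real_normK ?num_real // opp_gap_sqr // fne_constE //.
by move: s_lt; lra.
Qed.

Lemma cl_gap_sqr (w : R) : cl_gap w ^+ 2 = fne_const w ^+ 2 + 4 / gamma.
Proof. by rewrite sqr_sqrtr // addr_ge0 ?sqr_ge0 // divr_ge0 // ltW. Qed.

Lemma cl_gap_gt (w : R) : fne_const w < cl_gap w.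
Proof.
apply: (le_lt_trans (ler_norm _)).
rewrite -(ltr_pXn2r (n := 2)) // ?nnegrE ?sqrtr_ge0 //.
by rewrite real_normK ?num_real // cl_gap_sqr ltrDl divr_gt0.
Qed.

Lemma opp_cl_gap (w : R) : w != 0 -> opp_gap w < cl_gap w.
Proof.
move=> w_neq0; rewrite -(ltr_pXn2r (n := 2)) // ?nnegrE ?sqrtr_ge0 //.
rewrite cl_gap_sqr opp_gap_sqr //.
have : 0 < 4 / gamma by rewrite divr_gt0.
by move: s_gt0; lra.
Qed.

(** Put k = fne_const, d = w - S / w, E = opp_gap, F = cl_gap. Two
    expressions of [openloop] are monotone on different ranges.
    When k does not increase, use
      w + (F - E) / 2 = w + 2 (1 / gamma + s) / (F + E),
    since F and E do not increase with k. When k increases, use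
      (k + F) / 2 + (d - E) / 2,
    where d - E increases with d because E = sqrt (d^2 + 4 (S - s)). *)
Lemma openloop_lt (w w' : R) : 0 < w -> w < w' -> openloop w < openloop w'.
Proof.
move=> w_gt0 w_lt; have w'_gt0 := lt_trans w_gt0 w_lt.
have w_neq0 := lt0r_neq0 w_gt0; have w'_neq0 := lt0r_neq0 w'_gt0.
have E_ge0 : 0 <= opp_gap w := sqrtr_ge0 _.
have E'_ge0 : 0 <= opp_gap w' := sqrtr_ge0 _.
have Fk := cl_gap_gt w; have Fk' := cl_gap_gt w'.
have k_gt0 := fne_const_gt0 w_gt0; have k'_gt0 := fne_const_gt0 w'_gt0.
have F2 := cl_gap_sqr w; have F2' := cl_gap_sqr w'.
have E2 := opp_gap_sqr w_neq0; have E2' := opp_gap_sqr w'_neq0.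
have EF := opp_cl_gap w_neq0.
have := opp_gap_gt w_neq0; have := opp_gap_gt w'_neq0.
rewrite !ltr_norml => /andP[_ dE'] /andP[_ dE].
have Sw_lt : S / w' < S / w by rewrite ltr_pM2l // ltf_pV2.
rewrite /openloop.
have [k_le|k_lt] := leP (fne_const w') (fne_const w).
  have k2_le : fne_const w' ^+ 2 <= fne_const w ^+ 2.
    by rewrite ler_pXn2r // nnegrE ltW.
  have F'_le : cl_gap w' <= cl_gap w by rewrite ler_wsqrtr // lerD2r.
  have E'_le : opp_gap w' <= opp_gap w by rewrite ler_wsqrtr // lerD2r.
  suff : cl_gap w - opp_gap w <= cl_gap w' - opp_gap w' by lra.
  have EF' := opp_cl_gap w'_neq0.
  rewrite -(ler_pM2r (_ : 0 < cl_gap w + opp_gap w)); last by lra.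
  have -> : (cl_gap w - opp_gap w) * (cl_gap w + opp_gap w) =
      (cl_gap w' - opp_gap w') * (cl_gap w' + opp_gap w').
    by rewrite -!subr_sqr F2 F2' E2 E2'; ring.
  by rewrite ler_pM2l ?subr_gt0 // lerD.
have F_le : cl_gap w <= cl_gap w'.
  by rewrite ler_wsqrtr // lerD2r ler_pXn2r // ?nnegrE ltW.
have dE_lt : opp_gap w' - opp_gap w < (w' - S / w') - (w - S / w).
  rewrite -(ltr_pM2r (_ : 0 < opp_gap w' + opp_gap w)); last first.
    by have := fne_constE w'_neq0; have := opp_gap_gt w_neq0;
       have := normr_ge0 (w - S / w); lra.
  rewrite -subr_sqr E2 E2' !fne_constE //.
  rewrite -subr_gt0.
  have -> : ((w' - S / w') - (w - S / w)) * (opp_gap w' + opp_gap w) -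
     ((w' - S / w') ^+ 2 + 4 * S - 4 * s -
      ((w - S / w) ^+ 2 + 4 * S - 4 * s)) =
     ((w' - S / w') - (w - S / w)) *
     ((opp_gap w' - (w' - S / w')) + (opp_gap w - (w - S / w))) by ring.
  by rewrite mulr_gt0 //; lra.
by move: k_lt dE_lt F_le; rewrite /fne_const; lra.
Qed.

Lemma openloop_inj (w w' : R) :
  0 < w -> 0 < w' -> openloop w = openloop w' -> w = w'.
Proof.
move=> w_gt0 w'_gt0 ww'; case: (ltgtP w w') => // lt_ww'.
  by have := openloop_lt w_gt0 lt_ww'; rewrite ww' ltxx.
by have := openloop_lt w'_gt0 lt_ww'; rewrite ww' ltxx.
Qed.

Lemma openloop_continuous (w : R) : w != 0 -> {for w, continuous openloop}.
Proof.
move=> w_neq0.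
have k_cont : {for w, continuous fne_const}.
  apply: continuousD; first exact: cvg_id.
  apply: continuousM; first exact: cvg_cst.
  by apply: continuousV => //; exact: cvg_id.
have sqrt_cont m :
    {for w, continuous (fun x => Num.sqrt (fne_const x ^+ 2 + m))}.
  apply: (@continuous_comp _ _ _ (fun x => fne_const x ^+ 2 + m) Num.sqrt).
    apply: continuousD; last exact: cvg_cst.
    by apply: (continuousM k_cont k_cont).
  exact: sqrt_continuous.
apply: continuousD; first exact: cvg_id.
apply: continuousM; last exact: cvg_cst.
apply: continuousD; first exact: sqrt_cont.
by apply: continuousN; exact: sqrt_cont.
Qed.

(** Intermediate values between l = a / (1 + 2 T / S), T = 1 / gamma + s, and a.
    The bound at l comes from (F - E) (F + E) = 4 T and F >= k >= S / w, which
    give openloop w <= w + 2 T w / S. *)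
Lemma openloop_surj (a : R) : 0 < a -> exists2 w, 0 < w & openloop w = a.
Proof.
move=> a_gt0; set T := gamma^-1 + s.
have T_gt0 : 0 < T by rewrite addr_gt0 ?invr_gt0.
have D_gt0 : 0 < 1 + 2 * T / S by rewrite addr_gt0 ?divr_gt0 ?mulr_gt0.
set l := a / (1 + 2 * T / S).
have l_gt0 : 0 < l by rewrite divr_gt0.
have l_neq0 := lt0r_neq0 l_gt0.
have l_le : l <= a.
  rewrite ler_pdivrMr // ler_peMr ?(ltW a_gt0) // lerDl.
  by rewrite divr_ge0 ?ltW // mulr_gt0.
have openloop_l : openloop l <= a.
  have Fk := cl_gap_gt l; have k_gt0 := fne_const_gt0 l_gt0.
  have EF := opp_cl_gap l_neq0.
  have E_ge0 : 0 <= opp_gap l := sqrtr_ge0 _.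
  have gapE : (cl_gap l - opp_gap l) * (cl_gap l + opp_gap l) = 4 * T.
    by rewrite -subr_sqr cl_gap_sqr opp_gap_sqr // /T; ring.
  have Sl_gt0 : 0 < S / l by rewrite divr_gt0.
  have gap_le : (cl_gap l - opp_gap l) * (S / l) <= 4 * T.
    by rewrite -gapE ler_pM2l ?subr_gt0 //; move: Fk; rewrite /fne_const; lra.
  have : (cl_gap l - opp_gap l) <= 4 * T / (S / l) by rewrite ler_pdivlMr.
  have -> : 4 * T / (S / l) = 2 * (2 * T / S * l) by field; rewrite !lt0r_neq0.
  have aE : a = l + 2 * T / S * l.
    by rewrite -[X in X + _]mul1r -mulrDl mulrC mulfVK // lt0r_neq0.
  by rewrite /openloop; lra.
have openloop_a : a <= openloop a.
  by have := opp_cl_gap (lt0r_neq0 a_gt0); rewrite /openloop; lra.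
have [||w w_in w_a] := @IVT _ openloop l a a l_le.
- apply: continuous_in_subspaceT => w.
  rewrite inE /= in_itv /= => /andP[l_le_w _].
  by apply: openloop_continuous; rewrite lt0r_neq0 // (lt_le_trans l_gt0).
- by rewrite ge_min openloop_l /= le_max openloop_a orbT.
exists w => //; move: w_in; rewrite in_itv /= => /andP[l_le_w _].
exact: lt_le_trans l_le_w.
Qed.

(** The stationarity equations for the negated gains w and v, with closed
    loop c. *)
Definition gain_pair (a w v : R) : Prop :=
  let c := a - w - v in
  [/\ 0 < w, 0 < v, 0 < c,
      gamma * c * (S + w ^+ 2) = w * (1 - gamma * c ^+ 2) &
      gamma * c * (s + v ^+ 2) = v * (1 - gamma * c ^+ 2)].

Lemma gain_pair_const (a w v : R) : gain_pair a w v ->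
  gamma * (a - w - v) * fne_const w = 1 - gamma * (a - w - v) ^+ 2 /\
  s + v ^+ 2 = fne_const w * v.
Proof.
case; set c := a - w - v => w_gt0 v_gt0 c_gt0 eqw eqv.
have w_neq0 := lt0r_neq0 w_gt0.
have kE : S + w ^+ 2 = fne_const w * w by rewrite /fne_const; field.
have cE : gamma * c * fne_const w = 1 - gamma * c ^+ 2.
  by apply: (mulIf w_neq0) => /=; rewrite [RHS]mulrC -eqw kE; ring.
split=> //; apply: (mulfI (lt0r_neq0 (mulr_gt0 gamma_gt0 c_gt0))).
by rewrite /= eqv -cE; ring.
Qed.

Lemma gain_pair_cl (a w v : R) : gain_pair a w v ->
  2 * (a - w - v) = cl_gap w - fne_const w.
Proof.
move=> ne; have [cE _] := gain_pair_const ne; case: ne => w_gt0 _ c_gt0 _ _.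
have k_gt0 := fne_const_gt0 w_gt0.
set c := a - w - v in cE c_gt0 *.
suff -> : cl_gap w = 2 * c + fne_const w by ring.
apply/eqP; rewrite -(eqrXn2 (n := 2)) ?sqrtr_ge0 //; last by lra.
apply/eqP; rewrite cl_gap_sqr; apply: (mulfI (lt0r_neq0 gamma_gt0)).
have g4 : gamma * (4 / gamma) = 4 by field; rewrite lt0r_neq0.
rewrite mulrDr g4.
suff : gamma * c ^+ 2 + gamma * c * fne_const w = 1 by lra.
by rewrite cE; ring.
Qed.

(** The two branches of the FNE law: the lower root v is the bounded one. *)
Lemma gain_pair_opp (a w v : R) : gain_pair a w v ->
  2 * v = fne_const w - opp_gap w \/ 2 * v = fne_const w + opp_gap w.
Proof.
move=> ne; have [_ vE] := gain_pair_const ne; case: ne => w_gt0 _ _ _ _.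
have : (2 * v - fne_const w) ^+ 2 = opp_gap w ^+ 2.
  by rewrite opp_gap_sqr ?lt0r_neq0 //; lra.
move/eqP; rewrite eqf_sqr => /orP[] /eqP eqv; [right|left]; lra.
Qed.

Lemma lower_gain_pairP (a w : R) : 0 < w ->
  gain_pair a w ((fne_const w - opp_gap w) / 2) <-> openloop w = a.
Proof.
move=> w_gt0; set v := _ / 2; split=> [ne|openE].
  by have := gain_pair_cl ne; rewrite /v /openloop; lra.
have w_neq0 := lt0r_neq0 w_gt0.
have k_gt0 := fne_const_gt0 w_gt0.
have cE : a - w - v = (cl_gap w - fne_const w) / 2.
  by rewrite -openE /openloop /v; lra.
have Fk := cl_gap_gt w.
have F2 := cl_gap_sqr w; have E2 := opp_gap_sqr w_neq0.
have E_ge0 : 0 <= opp_gap w := sqrtr_ge0 _.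
have Ek : opp_gap w < fne_const w.
  rewrite -(ltr_pXn2r (n := 2)) ?nnegrE // ?(ltW k_gt0) // E2.
  by move: s_gt0; lra.
have ck : gamma * (a - w - v) * fne_const w = 1 - gamma * (a - w - v) ^+ 2.
  have gF2 : gamma * cl_gap w ^+ 2 = gamma * fne_const w ^+ 2 + 4.
    by rewrite F2; field; rewrite lt0r_neq0.
  by rewrite cE; lra.
have vE : s + v ^+ 2 = fne_const w * v by rewrite /v; lra.
have kE : S + w ^+ 2 = fne_const w * w by rewrite /fne_const; field.
split=> //=.
- by rewrite /v; lra.
- by rewrite cE; lra.
- by rewrite kE mulrA ck mulrC.
- by rewrite vE mulrA ck mulrC.
Qed.

(** At the upper root, 2 v = k + sqrt (k^2 - 4 s), and k >= 2 sqrt S by the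
    arithmetic-geometric inequality; moreover v < a as w and c are positive. *)
Lemma upper_gain_pair (a w v : R) : gain_pair a w v ->
  2 * v = fne_const w + opp_gap w ->
  Num.sqrt S + Num.sqrt (S - s) <= a.
Proof.
case=> w_gt0 _ c_gt0 _ _ vE; have w_neq0 := lt0r_neq0 w_gt0.
have k_gt0 := fne_const_gt0 w_gt0; have k2 := fne_constE w_neq0.
have d2_ge0 := sqr_ge0 (w - S / w).
have sqrtS : 2 * Num.sqrt S <= fne_const w.
  rewrite -(ler_pXn2r (n := 2)) ?nnegrE ?(ltW k_gt0) ?mulr_ge0 ?sqrtr_ge0 //.
  by rewrite exprMn sqr_sqrtr ?(ltW S_gt0) // k2; move: s_lt; lra.
have sqrtSs : 2 * Num.sqrt (S - s) <= opp_gap w.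
  rewrite -(ler_pXn2r (n := 2)) ?nnegrE ?mulr_ge0 ?sqrtr_ge0 //.
  rewrite exprMn sqr_sqrtr ?subr_ge0 ?(ltW s_lt) // opp_gap_sqr // k2.
  by move: s_lt; lra.
by lra.
Qed.

End BranchFunctions.

(** * Equilibria of the two-player game *)

Section Equilibria.
Variables (R : realType) (gamma : R) (sigma : player -> R).
Hypotheses (gamma_gt0 : 0 < gamma) (sigma_gt0 : forall j, 0 < sigma j).

Definition equilibrium (a : R) (x : profile R) : Prop :=
  gamma * a_cl a x ^+ 2 < 1 /\
  forall j, stationary gamma (sigma j) (a + x (~~ j)) (x j).

Lemma discounted_stableE (c : R) :
  (Num.sqrt gamma * `|c| < 1) = (gamma * c ^+ 2 < 1).
Proof.
rewrite -[RHS](@ltr_sqrt _ _ 1) // sqrtr1 sqrtrM ?sqrtr_sqr //.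
exact: ltW.
Qed.

Lemma discounted_stable_FNE_equilibrium (a : R) (r : player -> R)
    (x : profile R) :
  (forall j, 0 < r j) ->
  discounted_stable_FNE a gamma sigma r x <-> equilibrium a x.
Proof.
move=> r_gt0; rewrite /discounted_stable_FNE /equilibrium discounted_stableE.
by split=> [[ne lt1]|[lt1 st]]; split=> //; apply/(FNE_stationary (r := r)).
Qed.

Definition opp_profile (x : profile R) : profile R := [ffun j => - x j].

Lemma opp_profileK : involutive opp_profile.
Proof. by move=> x; apply/ffunP => j; rewrite !ffunE opprK. Qed.

Lemma equilibriumN (a : R) (x : profile R) :
  equilibrium a x -> equilibrium (- a) (opp_profile x).
Proof.
case=> lt1 st; split=> [|j].
  suff -> : a_cl (- a) (opp_profile x) = - a_cl a x by rewrite sqrrN.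
  by rewrite /a_cl !ffunE; ring.
have := st j; rewrite /stationary !ffunE -opprD -opprD !sqrrN => stj.
by rewrite !(mulNr, mulrN) -opprD stj oppr0.
Qed.

Lemma on_bounded_branchN (i : player) (x : profile R) :
  on_bounded_branch sigma i x -> on_bounded_branch sigma i (opp_profile x).
Proof.
case=> x_neq0 xE; split; first by rewrite ffunE oppr_eq0.
by rewrite !ffunE xE /r_minus sqrrN mulrN invrN mulrN.
Qed.

Section PositiveDrift.
Variables (a : R) (i : player).
Hypotheses (a_gt0 : 0 < a) (sigma_lt : sigma (~~ i) < sigma i).

Let S := sigma i.
Let s := sigma (~~ i).

(** Stationarity gives each gain the sign opposite to that of the closed loop.
    So if c <= 0 then both gains are nonnegative and c >= a > 0, a
    contradiction. *)
Lemma equilibrium_gain_pair (x : profile R) :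
  equilibrium a x <-> gain_pair gamma S s a (- x i) (- x (~~ i)).
Proof.
rewrite /gain_pair !opprK.
have clE : a_cl a x = a + x i + x (~~ i) by rewrite (a_clE _ _ i); ring.
have stE : (forall j, stationary gamma (sigma j) (a + x (~~ j)) (x j)) <->
    stationary gamma S (a + x (~~ i)) (x i) /\
    stationary gamma s (a + x i) (x (~~ i)).
  split=> [st|[sti sto] j].
    by split; [exact: st|have := st (~~ i); rewrite negbK].
  have [->//|j_neq_i] := eqVneq j i.
  suff -> : j = ~~ i by rewrite negbK.
  by case: j i j_neq_i => [] [].
rewrite /equilibrium stE /stationary clE.
rewrite (addrAC a (x (~~ i))); set c := a + x i + x (~~ i).
split=> [[lt1 [sti sto]]|[xi_lt0 xo_lt0 c_gt0 eqi eqo]].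
  have den_gt0 : 0 < 1 - gamma * c ^+ 2 by rewrite subr_gt0.
  have Si_gt0 : 0 < S + x i ^+ 2 by rewrite ltr_pwDl ?sqr_ge0 // sigma_gt0.
  have so_gt0 : 0 < s + x (~~ i) ^+ 2 by rewrite ltr_pwDl ?sqr_ge0 // sigma_gt0.
  have c_gt0 : 0 < c.
    rewrite ltNge; apply/negP => c_le0.
    have pos y : forall m : R, 0 < m ->
        y * (1 - gamma * c ^+ 2) + gamma * c * m = 0 -> 0 <= y.
      move=> m m_gt0 /eqP; rewrite addr_eq0 => /eqP yE.
      rewrite -(pmulr_lge0 _ den_gt0) yE oppr_ge0.
      by rewrite (pmulr_lle0 _ m_gt0) (pmulr_rle0 _ gamma_gt0).
    have := pos _ _ Si_gt0 sti; have := pos _ _ so_gt0 sto.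
    by move: c_le0 a_gt0; rewrite /c; lra.
  have neg y : forall m : R, 0 < m ->
      y * (1 - gamma * c ^+ 2) + gamma * c * m = 0 -> 0 < - y.
    move=> m m_gt0 yE; rewrite -(pmulr_lgt0 _ den_gt0).
    have -> : - y * (1 - gamma * c ^+ 2) = gamma * c * m by lra.
    by rewrite !mulr_gt0.
  split; [exact: neg Si_gt0 sti|exact: neg so_gt0 sto|exact: c_gt0|..].
    by rewrite sqrrN; lra.
  by rewrite sqrrN; lra.
rewrite sqrrN in eqi; rewrite sqrrN in eqo.
split; last by split; lra.
rewrite -subr_gt0 -(pmulr_rgt0 _ xi_lt0) -eqi.
by rewrite pmulr_rgt0 ?mulr_gt0 // ltr_pwDl ?sqr_ge0 // sigma_gt0.
Qed.

Lemma r_minusE (w : R) : 0 < w ->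
  r_minus sigma i (- w) = - ((fne_const S w - opp_gap S s w) / 2).
Proof.
move=> w_gt0; have w_neq0 := lt0r_neq0 w_gt0.
have kE : sigma i + w ^+ 2 = fne_const S w * w by rewrite /fne_const /S; field.
rewrite /r_minus sqrrN kE.
have -> : (fne_const S w * w) ^+ 2 - 4 * sigma (~~ i) * w ^+ 2 =
    w ^+ 2 * (fne_const S w ^+ 2 - 4 * s) by rewrite /s; ring.
rewrite sqrtrM ?sqr_ge0 // sqrtr_sqr (gtr0_norm w_gt0) -/(opp_gap S s w).
by field.
Qed.

Lemma bounded_equilibriumP (x : profile R) :
  (equilibrium a x /\ on_bounded_branch sigma i x) <->
  [/\ 0 < - x i, openloop gamma S s (- x i) = a &
      x (~~ i) = r_minus sigma i (x i)].
Proof.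
have lowerP : 0 < - x i -> x (~~ i) = r_minus sigma i (x i) ->
    - x (~~ i) = (fne_const S (- x i) - opp_gap S s (- x i)) / 2.
  by move=> xi_lt0 ->; rewrite -{1}(opprK (x i)) r_minusE // opprK.
have s_gt0 : 0 < s := sigma_gt0 _.
split=> [[ne [_ xo]]|[xi_lt0 openE xo]].
  have gp := (equilibrium_gain_pair x).1 ne; have [xi_lt0 _ _ _ _] := gp.
  split=> //; rewrite (lowerP xi_lt0 xo) in gp.
  exact/(lower_gain_pairP gamma_gt0 s_gt0 sigma_lt).
split; last by split; rewrite // -oppr_eq0 lt0r_neq0.
apply/equilibrium_gain_pair; rewrite lowerP //.
exact/(lower_gain_pairP gamma_gt0 s_gt0 sigma_lt).
Qed.

Lemma bounded_equilibrium_ex :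
  exists x, equilibrium a x /\ on_bounded_branch sigma i x.
Proof.
have [w w_gt0 openE] :=
  openloop_surj gamma_gt0 (sigma_gt0 (~~ i)) sigma_lt a_gt0.
exists [ffun j => if j == i then - w else r_minus sigma i (- w)].
apply/bounded_equilibriumP; rewrite !ffunE eqxx opprK.
by have -> : (~~ i == i) = false by case: (i).
Qed.

Lemma bounded_equilibrium_uniq (x y : profile R) :
  equilibrium a x -> on_bounded_branch sigma i x ->
  equilibrium a y -> on_bounded_branch sigma i y -> x = y.
Proof.
move=> nex bx ney by_.
have [xi_lt0 xa xo] := (bounded_equilibriumP x).1 (conj nex bx).
have [yi_lt0 ya yo] := (bounded_equilibriumP y).1 (conj ney by_).
have xy : x i = y i.
  apply: oppr_inj.
  apply: (openloop_inj gamma_gt0 (sigma_gt0 (~~ i)) sigma_lt) => //.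
  by rewrite xa ya.
apply/ffunP => j; have [->//|j_neq_i] := eqVneq j i.
suff -> : j = ~~ i by rewrite xo yo xy.
by case: j i j_neq_i => [] [].
Qed.

(** An equilibrium off the bounded branch lies on the upper one, which forces
    a large drift. *)
Lemma equilibrium_bounded_or_large (x : profile R) : equilibrium a x ->
  on_bounded_branch sigma i x \/
  Num.sqrt (sigma i) + Num.sqrt (sigma i - sigma (~~ i)) <= a.
Proof.
move=> /equilibrium_gain_pair gp; have [xi_lt0 _ _ _ _] := gp.
have s_gt0 : 0 < s := sigma_gt0 _.
have [lower|upper] := gain_pair_opp gamma_gt0 sigma_lt gp; last first.
  by right; exact: (upper_gain_pair s_gt0 sigma_lt gp upper).
left; split; first by rewrite -oppr_eq0 lt0r_neq0.
by rewrite -[in RHS](opprK (x i)) r_minusE //; lra.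
Qed.

End PositiveDrift.

End Equilibria.

(** The sign symmetry removes the assumption a > 0. *)
Lemma equilibrium_branches (R : realType) (a gamma : R) (sigma : player -> R)
    (i : player) :
  a != 0 -> 0 < gamma -> (forall j, 0 < sigma j) -> sigma (~~ i) < sigma i ->
  [/\ exists x, equilibrium gamma sigma a x /\ on_bounded_branch sigma i x,
      forall x y, equilibrium gamma sigma a x -> on_bounded_branch sigma i x ->
        equilibrium gamma sigma a y -> on_bounded_branch sigma i y -> x = y &
      forall x, equilibrium gamma sigma a x -> on_bounded_branch sigma i x \/
        Num.sqrt (sigma i) + Num.sqrt (sigma i - sigma (~~ i)) <= `|a|].
Proof.
move=> a_neq0 gamma_gt0 sigma_gt0 sigma_lt.
wlog a_gt0 : a a_neq0 / 0 < a => [wlog_pos|].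
  have [/wlog_pos|a_lt0|a0] := ltgtP 0 a; first exact; last first.
    by rewrite -a0 eqxx in a_neq0.
  have [||[x [nex bx]] uniq large] := wlog_pos (- a);
    rewrite ?oppr_eq0 ?oppr_gt0 //.
  split.
  - exists (opp_profile x); split; last exact: on_bounded_branchN.
    by rewrite -[a]opprK; exact: equilibriumN.
  - move=> y z ney bounded_y nez bounded_z; apply: (inv_inj (@opp_profileK R)).
    by apply: uniq; first [exact: equilibriumN|exact: on_bounded_branchN].
  - move=> y /equilibriumN /large; rewrite normrN.
    case=> [bounded_y|]; last by right.
    by left; rewrite -[y]opp_profileK; exact: on_bounded_branchN.
split.
- exact: bounded_equilibrium_ex.
- exact: (@bounded_equilibrium_uniq _ _ _ _ _ _ i).
- move=> x nex; rewrite gtr0_norm //.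
  exact: equilibrium_bounded_or_large nex.
Qed.

Theorem theorem4p1 (R : realType) (a gamma : R) (sigma r : player -> R)
    (i : player)
    (a_neq0 : a != 0)
    (gamma_gt0 : 0 < gamma) (gamma_le1 : gamma <= 1)
    (sigma_gt0 : forall j : player, 0 < sigma j)
    (r_gt0 : forall j : player, 0 < r j)
    (sigma_lt : sigma (~~ i) < sigma i) :
  (* (1) *)
  ((exists! x : profile R,
      discounted_stable_FNE a gamma sigma r x /\ on_bounded_branch sigma i x) /\
   (forall x y : profile R,
      stable_FNE a gamma sigma r x /\ on_bounded_branch sigma i x ->
      stable_FNE a gamma sigma r y /\ on_bounded_branch sigma i y ->
      x = y) /\
   (gamma = 1 ->
    exists! x : profile R,
      stable_FNE a gamma sigma r x /\ on_bounded_branch sigma i x)) /\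
  (* (2) *)
  ((multiple (stable_FNE a gamma sigma r) ->
    Num.sqrt (sigma i) + Num.sqrt (sigma i - sigma (~~ i)) <= `|a|) /\
   (multiple (discounted_stable_FNE a gamma sigma r) ->
    Num.sqrt (sigma i) + Num.sqrt (sigma i - sigma (~~ i)) <= `|a|)).

Proof.
have stable_discounted x : stable_FNE a gamma sigma r x ->
    discounted_stable_FNE a gamma sigma r x.
  case=> ne cl_lt1; split=> //; apply: le_lt_trans cl_lt1.
  by rewrite ler_piMl // -sqrtr1 ler_sqrt.
have discountedP x :=
  discounted_stable_FNE_equilibrium gamma_gt0 sigma_gt0 a x r_gt0.
have [[x0 [ne0 b0]] uniq large] :=
  equilibrium_branches a_neq0 gamma_gt0 sigma_gt0 sigma_lt.
have uniqD x y : discounted_stable_FNE a gamma sigma r x ->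
    on_bounded_branch sigma i x -> discounted_stable_FNE a gamma sigma r y ->
    on_bounded_branch sigma i y -> x = y.
  by move=> /discountedP nex bx /discountedP ney; exact: uniq.
have dx0 : discounted_stable_FNE a gamma sigma r x0 by apply/discountedP.
have multipleD : multiple (discounted_stable_FNE a gamma sigma r) ->
    Num.sqrt (sigma i) + Num.sqrt (sigma i - sigma (~~ i)) <= `|a|.
  case=> x [y [neq_xy dx dy]].
  have [bx|//] := large x ((discountedP x).1 dx).
  have [bounded_y|//] := large y ((discountedP y).1 dy).
  by case: neq_xy; exact: uniqD.
split; split.
- by exists x0; split=> // y [dy bounded_y]; exact: uniqD.
- split=> [x y [/stable_discounted dx bx] [/stable_discounted dy bounded_y]|
            gamma1].
    exact: uniqD.
  exists x0; split=> [|y [/stable_discounted dy bounded_y]]; last exact: uniqD.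
  by case: dx0; rewrite gamma1 sqrtr1 mul1r.
- case=> x [y [neq_xy sx sy]]; apply: multipleD.
  by exists x, y; split=> //; exact: stable_discounted.
- exact: multipleD.
Qed.
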